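(* Let $n\geq 2$ be an integer and let $\mathcal{S}_n=\mathcal{R}(K_{1,n})$ be the rotation graph of the star $K_{1,n}$ with $n$ leaves. Then the adjacency matrix of $\mathcal{S}_n$ has an eigenvalue $\mu$ of multiplicity at least $n-1$ such that $$n>|\mu|>n-\frac{3}{n}-\frac{1}{n^2-n}.$$ (Here $n=\lambda_1$ is the largest eigenvalue of $\mathcal{S}_n$.)
   Context: Graphs are finite, simple and undirected. A search tree $T$ on a connected graph $G$ is a rooted tree with vertex set $V(G)$, defined recursively: the root of $T$ is a chosen vertex $r\in V(G)$, and the children of $r$ are the roots of search trees on each of the connected components of $G-r$. Let $T$ be a search tree on $G$ and let $v$ be a child of $u$ in $T$. The $uv$-rotation transforms $T$ into the search tree $T'$ on $G$ such that: (i) $u$ is a child of $v$ in $T'$; if $u$ is the root of $T$ then $v$ is the root of $T'$, otherwise, if $p$ is the parent of $u$ in $T$, then $p$ is the parent of $v$ in $T'$; (ii) every subtree of $u$ in $T$ other than the one rooted at $v$ remains a subtree of $u$ in $T'$; (iii) each subtree $S$ of $v$ in $T$ becomes a subtree of $u$ in $T'$ if $u$ is adjacent in $G$ to some vertex of $S$, and otherwise remains a subtree of $v$. All other parent-child relations are unchanged. The rotation graph $\mathcal{R}(G)$ is the undirected graph whose vertices are the search trees on $G$, two search trees being adjacent if one is obtained from the other by a single rotation. $\mathcal{S}_n$ is $n$-regular. *)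

(* Defs.v *)
From mathcomp Require Import all_boot all_order all_algebra.
From mathcomp Require Import boolp reals.

Set Implicit Arguments.
Unset Strict Implicit.
Unset Printing Implicit Defensive.

Import Order.TTheory GRing.Theory Num.Theory.

(* A simple graph is a symmetric irreflexive relation [e] on a finite type [V];
   a rooted tree with vertex set [V] is encoded by its parent map
   [p : {ffun V -> option V}], with [p r = None] exactly at the root [r]. *)
Section RotationGraph.
Variables (V : finType) (e : rel V).

Definition induced (A : {set V}) : rel V :=
  [rel x y | [&& x \in A, y \in A & e x y]].

Definition components (A : {set V}) : {set {set V}} :=
  equivalence_partition (connect (induced A)) A.

(* [search_tree_on p A q]: the restriction of [p] to [A] is a search tree on
   the induced subgraph [G[A]], whose root is attached to [q] ([Some] parent
   outside [A], or [None]). *)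
Inductive search_tree_on (p : {ffun V -> option V}) :
    {set V} -> option V -> Prop :=
| SearchTreeOn (A : {set V}) (q : option V) (r : V) of
    r \in A & p r = q
    & (forall C, C \in components (A :\ r) -> search_tree_on p C (Some r)) :
    search_tree_on p A q.

Definition is_search_tree (p : {ffun V -> option V}) : bool :=
  `[< search_tree_on p [set: V] None >].

Definition search_tree : finType :=
  {p : {ffun V -> option V} | is_search_tree p}.

(* The vertex set of the subtree rooted at [w], including [w]. *)
Definition subtree (p : {ffun V -> option V}) (w : V) : {set V} :=
  [set x | connect [rel y z | p z == Some y] w x].

(* Parent map after the [uv]-rotation; meaningful when [p v = Some u]. *)
Definition rotate (p : {ffun V -> option V}) (u v : V) : {ffun V -> option V} :=
  [ffun w => if w == v then p u
             else if w == u then Some v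
             else if (p w == Some v) && [exists x in subtree p w, e u x]
             then Some u
             else p w].

Definition rotates_to (T T' : search_tree) : bool :=
  [exists u, exists v,
    (sval T v == Some u) && (sval T' == rotate (sval T) u v)].

Definition rotation_adj : rel search_tree :=
  [rel T T' | rotates_to T T' || rotates_to T' T].

End RotationGraph.

Arguments rotation_adj {V} e.

(* The star K_{1,n}, with centre [ord0]. *)
Definition star (n : nat) : rel 'I_n.+1 :=
  [rel x y | (x == ord0) != (y == ord0)].
Arguments star n : clear implicits.

Lemma star_sym n : symmetric (star n).
Proof. by move=> x y; rewrite /star /=; case: (x == ord0); case: (y == ord0). Qed.

Lemma star_irrefl n : irreflexive (star n).
Proof. by move=> x; rewrite /star /= eqxx. Qed.

Lemma star_connected n (x y : 'I_n.+1) : connect (star n) x y.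
Proof.
have c0 z : connect (star n) ord0 z.
  have [->|z0] := eqVneq z ord0; first exact: connect0.
  by apply: connect1; rewrite /star /= eqxx (negPf z0).
apply: connect_trans (c0 y).
by rewrite (sym_connect_sym (@star_sym n)) c0.
Qed.

Definition adjmx (R : nzRingType) (T : finType) (a : rel T) : 'M[R]_#|T| :=
  (\matrix_(i, j) (a (enum_val i) (enum_val j))%:R)%R.

(* Main.v *)
Require Import Defs.
From mathcomp Require Import all_boot all_order all_algebra.
From mathcomp Require Import perm complex.
From mathcomp Require Import boolp reals.
From mathcomp Require Import ring lra zify.

(** Below the root, a search tree on the star K_{1,n} is a path of leaves that
    ends at the centre, and all remaining leaves hang from the centre; so search
    trees are the duplicate-free words [s] over the [n] leaves
    ([is_search_tree_word]), the empty word being the tree rooted at the centre.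
    A rotation inserts an absent leaf at the end of the word, removes its last
    leaf, or exchanges two consecutive leaves ([rotate_nbrs]).  In particular
    the graph is [n]-regular and connected, hence [n] is its largest eigenvalue and
    only constant functions belong to it.

    For a leaf [a] let [depth s a] be the affine image 2 p - (n - 1) of the
    position p of [a] in [s], or of its mean position in a random completion of
    [s] when [a] is absent.  These [n] functions of [s] sum to zero and are
    permuted by the relabellings of the leaves, which are automorphisms of the
    graph.  As an average over completions, the depth is harmonic for
    insertions; only swaps and removals contribute to the quadratic form of
    n - A.  With m the number of absent leaves, the sum over [a] of this form at
    a nonempty word of size k is 4 (k - 1) + m (m + 1) ([depth_energy]), whereas
    the squared norm is (n^3 - n - m^3 + m) / 3 ([depth_norm]).  Double counting
    the insertions yields the factorial moments of m over all trees
    ([moment_shift]), and the Rayleigh quotient of n - A is found to be smaller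
    than 3/n + 1/(n^2 - n) ([rayleigh_gap]).

    By the spectral theorem there is an eigenvalue mu above
    n - 3/n - 1/(n^2 - n) onto whose eigenspace the depth functions have nonzero
    projections ([symmetric_eigenvectors_above]).  The projection commutes with
    the automorphisms, so the [n] projected vectors still sum to zero and are
    still permuted by all transpositions: they span a copy of the standard
    representation of the symmetric group, of dimension n - 1
    ([rank_permuted_rows]).  Finally mu < n, because for mu = n the projected
    functions would be constant, hence all equal, hence zero. *)

Set Implicit Arguments.
Unset Strict Implicit.
Unset Printing Implicit Defensive.

Import Order.TTheory GRing.Theory Num.Theory.

(** * Search trees on a star as words of leaves *)

Section StarTrees.
Variable n : nat.

Definition leaf (a : 'I_n) : 'I_n.+1 := lift ord0 a.

Lemma leaf_inj : injective leaf. Proof. exact: lift_inj. Qed.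

Lemma leaf_neq0 a : (leaf a == ord0) = false. Proof. by []. Qed.

Lemma centre_or_leaf w : w = ord0 \/ exists a, w = leaf a.
Proof. by case: (unliftP ord0 w) => [a ->|->]; [right; exists a | left]. Qed.

Lemma star_leaf a w : star n (leaf a) w = (w == ord0).
Proof. by rewrite /star /= leaf_neq0; case: (w == ord0). Qed.

Lemma mem_leaf a s : (leaf a \in map leaf s) = (a \in s).
Proof. exact/mem_map/leaf_inj. Qed.

(** A star is still connected after deleting leaves, every vertex being
    joined to the centre. *)
Lemma components_centre (A C : {set 'I_n.+1}) : ord0 \in A ->
  (C \in components (star n) A) = (C == A).
Proof.
move=> A0; have conn x y : x \in A -> y \in A -> connect (induced (star n) A) x y.
  have c0 z : z \in A -> connect (induced (star n) A) ord0 z /\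
                         connect (induced (star n) A) z ord0.
    move=> Az; case: (centre_or_leaf z) => [->|[a za]]; first by rewrite connect0.
    by split; apply: connect1; rewrite /induced /= A0 Az za.
  by move=> /c0[_ x0] /c0[y0 _]; apply: connect_trans x0 y0.
have comp x : x \in A -> [set y in A | connect (induced (star n) A) x y] = A.
  by move=> Ax; apply/setP=> y; rewrite inE; case Ay: (y \in A) => //=; rewrite conn.
apply/imsetP/eqP => [[x Ax ->]|->]; first exact: comp.
by exists ord0 => //; rewrite comp.
Qed.

(** Without the centre no edge is left. *)
Lemma components_leaves (A C : {set 'I_n.+1}) : ord0 \notin A ->
  reflect (exists2 x, x \in A & C = [set x]) (C \in components (star n) A).
Proof.
move=> A0; have comp x : x \in A ->
    [set y in A | connect (induced (star n) A) x y] = [set x].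
  move=> Ax; apply/setP=> y; rewrite !inE.
  apply/andP/eqP => [[Ay /connectP[[|z p] /=]]|->]; rewrite ?connect0 //.
  case/andP=> /and3P[_ Az xz] _ _; case/negP: A0.
  case: (centre_or_leaf x) => [<-//|[a xa]].
  by move: xz; rewrite xa star_leaf => /eqP <-.
by apply: (iffP imsetP) => -[x Ax ->]; exists x => //; rewrite comp.
Qed.

(** The parent map of the tree of [s] when its root has parent [q]: each letter
    hangs from the preceding one, the centre from the last letter, and the leaves
    outside [s] from the centre. *)
Fixpoint word_parent (q : option 'I_n.+1) (s : seq 'I_n) (w : 'I_n.+1) :=
  if s is a :: s' then
    if w == leaf a then q else word_parent (Some (leaf a)) s' w
  else if w == ord0 then q else Some ord0.

(** The word lists the successive roots until the centre is chosen: deleting a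
    leaf leaves a single component, deleting the centre leaves only singletons. *)
Lemma search_tree_word p A q : search_tree_on (star n) p A q -> ord0 \in A ->
  exists s, [/\ uniq s, all (fun a => leaf a \in A) s
              & forall w, w \in A -> p w = word_parent q s w].
Proof.
elim=> {}A {}q r Ar pr sub IH A0.
case: (centre_or_leaf r) => [r0|[b rb]].
  exists [::]; split=> // w Aw /=; have [->|w0] := eqVneq w ord0; first by rewrite -r0.
  have : [set w] \in components (star n) (A :\ r).
    apply/components_leaves; first by rewrite r0 !inE eqxx.
    by exists w; rewrite // !inE r0 w0.
  move/sub; rewrite r0 => H; inversion H as [B q' x xw px _ eB eq].
  by move: xw; rewrite inE => /eqP <-.
have A'0 : ord0 \in A :\ r by rewrite !inE A0 rb.
have [||s [us As ps]] := IH (A :\ r) => //; first by rewrite components_centre.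
exists (b :: s); rewrite /= us -rb Ar andbT; split.
- apply: contraT; rewrite negbK => /(allP As); by rewrite -rb setD11.
- by apply: sub_all As => a; rewrite inE => /andP[].
- move=> w Aw; have [->|nwr] := eqVneq w r; first by rewrite pr.
  by rewrite ps // !inE nwr.
Qed.

Lemma word_search_tree (p : {ffun 'I_n.+1 -> option 'I_n.+1}) s
    (A : {set 'I_n.+1}) q : uniq s -> all (fun a => leaf a \in A) s ->
    ord0 \in A -> (forall w, w \in A -> p w = word_parent q s w) ->
  search_tree_on (star n) p A q.
Proof.
elim: s A q => [|b s IH] A q us As A0 ps.
  apply: (SearchTreeOn A0) => [|C]; first by rewrite ps.
  case/components_leaves => [|w]; first by rewrite setD11.
  rewrite !inE => /andP[w0 Aw] ->; apply: (@SearchTreeOn _ _ _ _ _ w).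
  - by rewrite inE.
  - by rewrite ps // /= (negPf w0).
  - by move=> D; rewrite setDv => /imsetP[x]; rewrite inE.
case/andP: us => bs us; case/andP: As => Ab As.
apply: (SearchTreeOn Ab) => [|C]; first by rewrite ps //= eqxx.
have A'0 : ord0 \in A :\ leaf b by rewrite !inE A0.
rewrite components_centre // => /eqP ->; apply: IH => //.
- apply/allP=> a sa; rewrite !inE (allP As) // andbT (inj_eq leaf_inj).
  by apply: contraNneq bs => <-.
- by move=> w; rewrite !inE => /andP[nw Aw]; rewrite ps //= (negPf nw).
Qed.

Definition word_ffun s : {ffun 'I_n.+1 -> option 'I_n.+1} :=
  [ffun w => word_parent None s w].

Lemma is_search_tree_word p :
  reflect (exists2 s, uniq s & p = word_ffun s) (is_search_tree (star n) p).
Proof.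
apply: (iffP (asboolP _)) => [/search_tree_word[]|[s us ->]]; first by rewrite inE.
  by move=> s [us _ ps]; exists s => //; apply/ffunP=> w; rewrite ffunE ps ?inE.
apply: (@word_search_tree _ s); rewrite ?inE //; first by apply/allP=> a; rewrite inE.
by move=> w; rewrite ffunE.
Qed.

Lemma word_parent_range q s w :
  word_parent q s w \in [:: q, Some ord0 & map (Some \o leaf) s].
Proof.
elim: s q => [|a s IH] q /=; first by case: eqP => _; rewrite !inE eqxx ?orbT.
case: eqP => _; first by rewrite inE eqxx.
have := IH (Some (leaf a)); rewrite !inE.
by do 3?case/orP; move=> ->; rewrite ?orbT.
Qed.

Lemma word_parent0 q s : word_parent q s ord0 = last q (map (Some \o leaf) s).
Proof. by elim: s q => //= a s IH q; rewrite IH. Qed.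

Lemma word_parent_out q s a : a \notin s -> word_parent q s (leaf a) = Some ord0.
Proof.
elim: s q => //= b s IH q; rewrite inE negb_or (inj_eq leaf_inj).
by case/andP=> /negPf-> /IH.
Qed.

Lemma word_parent_cat q s1 s2 w : w \notin map leaf s1 ->
  word_parent q (s1 ++ s2) w = word_parent (last q (map (Some \o leaf) s1)) s2 w.
Proof.
elim: s1 q => //= b s IH q; rewrite inE negb_or.
by case/andP=> /negPf-> /IH.
Qed.

Lemma word_parent_prefix q s1 s2 w : w \in map leaf s1 ->
  word_parent q (s1 ++ s2) w = word_parent q s1 w.
Proof.
by elim: s1 q => //= b s IH q; rewrite inE; case: eqP => //= _ /IH.
Qed.

Lemma word_parent_rcons q s a w : w != leaf a -> w != ord0 ->
  word_parent q (rcons s a) w = word_parent q s w.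
Proof.
move=> wa w0; elim: s q => [|b s IH] q /=; last by rewrite IH.
by rewrite (negPf wa) (negPf w0).
Qed.

(** The condition under which [q] occurs as a parent in [word_parent q s]
    only at the root. *)
Definition above q (s : seq 'I_n) :=
  q != Some ord0 /\ q \notin map (Some \o leaf) s.

Lemma above_leaf a s : a \notin s -> above (Some (leaf a)) s.
Proof.
move=> nas; split=> //; rewrite mem_map //.
by apply: inj_comp leaf_inj => b c [].
Qed.

Lemma word_parent_change q q' s w : above q s ->
  word_parent q' s w = if word_parent q s w == q then q' else word_parent q s w.
Proof.
elim: s q q' => [|a s IH] q q' [q0 /= nq].
  by case: ifP; rewrite ?eqxx // [_ == q]eq_sym (negPf q0).
case: ifP => _; first by rewrite eqxx.
case: eqP => // e; have := word_parent_range (Some (leaf a)) s w.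
rewrite e inE orbC inE (negPf q0) /= orbC.
by rewrite !inE in nq; case/norP: nq => /negPf-> /negPf->.
Qed.

Lemma word_parent_inj q s s' : uniq s -> uniq s' -> above q s -> above q s' ->
    (forall w, word_parent q s w = word_parent q s' w) -> s = s'.
Proof.
have last_in (x : option 'I_n.+1) t : last x t \in x :: t by apply: mem_last.
have nil q' a t : above q' (a :: t) ->
  (forall w, word_parent q' [::] w = word_parent q' (a :: t) w) -> False.
  move=> [_ /negP nq] /(_ ord0); rewrite /= word_parent0 => e; apply: nq.
  by rewrite {1}e; apply: last_in.
elim: s s' q => [|a s IH] [|b s'] q // us us' qs qs' e.
- by case: (nil q b s').
- by case: (nil q a s) => // w; rewrite e.
have ab : a = b.
  apply/eqP; have := e (leaf a); rewrite /= eqxx (inj_eq leaf_inj).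
  case: (a == b) => // eq; have := word_parent_range (Some (leaf b)) s' (leaf a).
  case: qs' => /negPf q0; rewrite /= -eq !inE q0 orFb.
  by case/norP=> /negPf-> /negPf->.
rewrite -ab in e us' qs' *; case/andP: us => nas us; case/andP: us' => nas' us'.
congr (_ :: _); apply: (IH s' (Some (leaf a))) => // [||w]; try exact: above_leaf.
have := e w; rewrite /=; case: eqP => // -> _.
by rewrite !word_parent_out.
Qed.

Lemma word_ffun_inj s s' : uniq s -> uniq s' -> word_ffun s = word_ffun s' -> s = s'.
Proof.
move=> us us' /ffunP e; have ab t : above None t.
  by split=> //; apply/mapP=> -[].
by apply: (@word_parent_inj None) => // w; have := e w; rewrite !ffunE.
Qed.

(** * Rotations of words *)

(** The centre lies below every letter of the word; this decides the adjacency
    test of a rotation, since the centre is the only neighbour of a leaf. *)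
Lemma subtree_centre (s : seq 'I_n) w :
    uniq s -> w = ord0 \/ (exists2 a, a \in s & w = leaf a) ->
  ord0 \in subtree (word_ffun s) w.
Proof.
move=> us [->|[a sa ->]]; rewrite inE ?connect0 //.
case/splitPr: sa us => s1 s2 us; set e := [rel _ _ | _].
elim: s2 s1 a @e us => [|b s2 IH] s1 a e us.
  by apply: connect1; rewrite /e /= ffunE word_parent0 map_cat last_cat /=.
have := IH (rcons s1 a) b; rewrite cat_rcons => /(_ us); apply: connect_trans.
apply: connect1; rewrite /e /= ffunE -cat_rcons word_parent_cat.
  by rewrite /= eqxx map_rcons last_rcons.
rewrite mem_leaf; move: us; rewrite -cat_rcons uniq_catC /= => /andP[].
by rewrite mem_cat => /norP[].
Qed.

Lemma rotate_insert s a : a \notin s ->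
  rotate (star n) (word_ffun s) ord0 (leaf a) = word_ffun (rcons s a).
Proof.
move=> nas; apply/ffunP=> w; rewrite !ffunE.
have [->|wa] := eqVneq w (leaf a).
  rewrite -cats1 word_parent_cat ?mem_leaf //= eqxx word_parent0 //.
have [->|w0] := eqVneq w ord0; first by rewrite word_parent0 map_rcons last_rcons.
rewrite word_parent_rcons //; case: eqP => //= e.
have := word_parent_range None s w; rewrite e !inE /=.
by have [_ /negPf->] := above_leaf nas.
Qed.

(** Only leaves outside the word are children of the centre, and their
    subtrees are singletons that are not adjacent to the leaf [a], so they all
    stay with the centre. *)
Lemma rotate_remove s a : uniq (rcons s a) ->
  rotate (star n) (word_ffun (rcons s a)) (leaf a) ord0 = word_ffun s.
Proof.
rewrite rcons_uniq => /andP[nas us]; apply/ffunP=> w; rewrite !ffunE.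
have [->|w0] := eqVneq w ord0.
  by rewrite -cats1 word_parent_cat ?mem_leaf //= eqxx word_parent0.
have [->|wa] := eqVneq w (leaf a); first by rewrite word_parent_out.
rewrite word_parent_rcons //; case: eqP => //= e; case: existsP => // -[x].
rewrite star_leaf => /andP[+ /eqP x0]; rewrite {}x0 inE => /connectP[] p.
case: p => [_ /= ew|y p /= /andP[+ _] _]; first by rewrite ew eqxx in w0.
rewrite ffunE => /eqP py; case: (centre_or_leaf w) => [w0'|[c wc]].
  by rewrite w0' eqxx in w0.
have cs : c \notin rcons s a.
  rewrite mem_rcons inE negb_or; apply/andP; split.
    by rewrite -(inj_eq leaf_inj) -wc.
  apply/negP=> /splitPr cs; case: cs e us => s1 s2.
  rewrite wc uniq_catC /= mem_cat negb_or => + /andP[/andP[_ c1] _].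
  rewrite word_parent_cat ?mem_leaf //= eqxx; case/lastP: s1 c1 => // s1 d _.
  by rewrite map_rcons last_rcons.
have := word_parent_range None (rcons s a) y; rewrite py wc !inE /=.
by have [_ /negPf->] := above_leaf cs.
Qed.

(** The only subtree below [b] contains the centre, so it is always transferred
    to [a]. *)
Lemma rotate_swap s1 a b s2 : uniq (s1 ++ a :: b :: s2) ->
  rotate (star n) (word_ffun (s1 ++ a :: b :: s2)) (leaf a) (leaf b)
    = word_ffun (s1 ++ b :: a :: s2).
Proof.
move=> us; apply/ffunP=> w; rewrite !ffunE.
have us' := us; rewrite cat_uniq /= !negb_or in us'.
case/and3P: us' => us1 /and3P[as1 bs1 _] /and3P[].
case/andP=> ab as2 bs2 us2.
have ba : (leaf b == leaf a) = false by rewrite (inj_eq leaf_inj) eq_sym (negPf ab).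
have [->|wb] := eqVneq w (leaf b).
  by rewrite !word_parent_cat ?mem_leaf //= !eqxx.
have [->|wa] := eqVneq w (leaf a).
  by rewrite word_parent_cat ?mem_leaf //= eq_sym ba eqxx.
have [ws1|ws1] := boolP (w \in map leaf s1).
  rewrite !word_parent_prefix //; case: eqP => //= e.
  have := word_parent_range None s1 w; rewrite e !inE /=.
  by have [_ /negPf->] := above_leaf bs1.
rewrite !word_parent_cat //= (negPf wa) (negPf wb).
rewrite (@word_parent_change (Some (leaf b)) (Some (leaf a))); last exact: above_leaf.
case: eqP => //= e; case: existsP => //= -[]; exists ord0; rewrite star_leaf andbT.
apply: subtree_centre => //; case: (centre_or_leaf w) => [|[c wc]]; [by left | right].
exists c => //; rewrite mem_cat !inE; apply: contraT.
rewrite !negb_or => /and4P[_ _ _ cs2].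
by move: e; rewrite wc word_parent_out.
Qed.

(** The three kinds of parent-child pairs of a tree are the three kinds of
    rotations. *)
Lemma word_edge s u v : uniq s -> word_ffun s v = Some u ->
  [\/ exists a, [/\ a \notin s, u = ord0 & v = leaf a],
      exists s1 a, [/\ s = rcons s1 a, u = leaf a & v = ord0]
    | exists s1 a b s2, [/\ s = s1 ++ a :: b :: s2, u = leaf a & v = leaf b]].
Proof.
move=> us; rewrite ffunE; case: (centre_or_leaf v) => [->|[b ->]].
  rewrite word_parent0; case/lastP: s us => // s1 a _.
  by rewrite map_rcons last_rcons => -[<-]; constructor 2; exists s1, a.
have [bs|nbs] := boolP (b \in s); last first.
  by rewrite word_parent_out // => -[<-]; constructor 1; exists b.
case/splitPr: bs us => s1 s2 us; rewrite word_parent_cat ?mem_leaf; last first.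
  by move: us; rewrite uniq_catC /= => /andP[]; rewrite mem_cat => /norP[].
rewrite /= eqxx; case/lastP: s1 us => // s1 a _.
rewrite map_rcons last_rcons => -[<-]; constructor 3; exists s1, a, b, s2.
by rewrite cat_rcons.
Qed.

Fixpoint swaps (s : seq 'I_n) : seq (seq 'I_n) :=
  if s is a :: (b :: t) as s' then (b :: a :: t) :: map (cons a) (swaps s') else [::].

Lemma swapsP s s' : reflect
  (exists s1 a b s2, s = s1 ++ a :: b :: s2 /\ s' = s1 ++ b :: a :: s2)
  (s' \in swaps s).
Proof.
apply: (iffP idP) => [|[s1 [a [b [s2 [-> ->]]]]]]; last first.
  elim: s1 => [|c s1 IH]; first by rewrite inE eqxx.
  case: s1 IH => [|d s1] IH; rewrite inE; apply/orP; right; apply: map_f; exact: IH.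
elim: s s' => // a [|b t] // IH s'; rewrite inE => /predU1P[->|].
  by exists [::], a, b, t.
case/mapP=> t' /IH[s1 [a' [b' [s2 [-> ->]]]]] ->.
by exists (a :: s1), a', b', s2.
Qed.

Definition insertions (s : seq 'I_n) := [seq rcons s a | a <- enum 'I_n & a \notin s].
Definition removal (s : seq 'I_n) := if s is a :: t then [:: belast a t] else [::].
Definition nbrs s := insertions s ++ removal s ++ swaps s.

Lemma insertionsP s s' : reflect (exists2 a, a \notin s & s' = rcons s a)
  (s' \in insertions s).
Proof.
apply: (iffP mapP) => -[a]; first by rewrite mem_filter => /andP[nas _] ->; exists a.
by move=> nas ->; exists a; rewrite // mem_filter nas mem_enum.
Qed.

Lemma removalP s s' : reflect (exists a, s = rcons s' a) (s' \in removal s).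
Proof.
case/lastP: s => [|s a]; first by right=> -[a /(congr1 size)]; rewrite size_rcons.
have -> : removal (rcons s a) = [:: s].
  by case: s => //= b s; rewrite belast_rcons.
rewrite inE; apply: (iffP eqP) => [->|[b /rcons_inj[]]//]; by exists a.
Qed.

Lemma rotate_nbrs s s' : uniq s ->
  (exists u v, word_ffun s v = Some u /\
               word_ffun s' = rotate (star n) (word_ffun s) u v)
  <-> (exists2 t, word_ffun s' = word_ffun t & t \in nbrs s).
Proof.
move=> us; split=> [[u [v [/(word_edge us) uv ->]]]|[t ->]].
  case: uv => [[a [nas -> ->]]|[s1 [a [es -> ->]]]|[s1 [a [b [s2 [es -> ->]]]]]].
  - exists (rcons s a); first exact: rotate_insert.
    by rewrite !mem_cat; apply/orP; left; apply/insertionsP; exists a.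
  - exists s1; first by rewrite es rotate_remove // -es.
    by rewrite !mem_cat; apply/or3P; constructor 2; apply/removalP; exists a.
  - exists (s1 ++ b :: a :: s2); first by rewrite es rotate_swap // -es.
    by rewrite !mem_cat; apply/or3P; constructor 3; apply/swapsP; exists s1, a, b, s2.
rewrite !mem_cat => /or3P[/insertionsP[a nas ->]|/removalP[a es]|].
- exists ord0, (leaf a); rewrite rotate_insert //; split=> //.
  by rewrite ffunE word_parent_out.
- exists (leaf a), ord0; rewrite es rotate_remove -?es //; split=> //.
  by rewrite es ffunE word_parent0 map_rcons last_rcons.
- case/swapsP=> s1 [a [b [s2 [es ->]]]]; exists (leaf a), (leaf b).
  rewrite es rotate_swap -?es //; split=> //; rewrite ffunE es.
  rewrite -cat_rcons word_parent_cat /= ?eqxx ?map_rcons ?last_rcons //.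
  rewrite -map_rcons mem_leaf; move: us.
  by rewrite es -cat_rcons uniq_catC /= => /andP[]; rewrite mem_cat => /norP[].
Qed.

Lemma swaps_uniq s : uniq s -> uniq (swaps s).
Proof.
elim: s => // a [|b t] // IH /andP[nas us]; rewrite [swaps _]/= cons_uniq.
apply/andP; split; last by rewrite map_inj_uniq ?IH // => x y [].
by apply/mapP=> -[x _ [ab _]]; rewrite ab inE eqxx in nas.
Qed.

Lemma nbrs_uniq s : uniq s -> uniq (nbrs s).
Proof.
move=> us; have sz_ins t : t \in insertions s -> size t = (size s).+1.
  by case/insertionsP=> a _ ->; rewrite size_rcons.
have sz_rem t : t \in removal s -> (size t).+1 = size s.
  by case/removalP=> a ->; rewrite size_rcons.
have sz_swap t : t \in swaps s -> size t = size s.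
  by case/swapsP=> s1 [a [b [s2 [-> ->]]]]; rewrite !size_cat.
rewrite !cat_uniq swaps_uniq // andbT; apply/and4P; split.
- by rewrite map_inj_uniq ?filter_uniq -?enumT ?enum_uniq // => a b /rcons_inj[].
- apply/hasPn=> t; rewrite mem_cat => ts; apply/negP=> /sz_ins.
  by case/orP: ts => [/sz_rem|/sz_swap]; lia.
- by case: (s).
- by apply/hasPn=> t /sz_swap ts; apply/negP=> /sz_rem; lia.
Qed.

Lemma nbrs_map (f : 'I_n -> 'I_n) s t : injective f ->
  t \in nbrs s -> map f t \in nbrs (map f s).
Proof.
move=> fI; rewrite !mem_cat => /or3P[/insertionsP[a nas ->]|/removalP[a ->]|].
- by apply/orP; left; apply/insertionsP; exists (f a); rewrite ?mem_map // map_rcons.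
- by apply/or3P; constructor 2; apply/removalP; exists (f a); rewrite map_rcons.
- case/swapsP=> s1 [a [b [s2 [-> ->]]]]; apply/or3P; constructor 3.
  by apply/swapsP; exists (map f s1), (f a), (f b), (map f s2); rewrite !map_cat.
Qed.

Lemma nbrs_sym s t : uniq s -> t \in nbrs s -> s \in nbrs t.
Proof.
move=> us; rewrite !mem_cat => /or3P[/insertionsP[a nas ->]|/removalP[a es]|].
- by apply/or3P; constructor 2; apply/removalP; exists a.
- apply/or3P; constructor 1; apply/insertionsP; exists a => //.
  by move: us; rewrite es rcons_uniq => /andP[].
- case/swapsP=> s1 [a [b [s2 [-> ->]]]]; apply/or3P; constructor 3.
  by apply/swapsP; exists s1, b, a, s2.
Qed.

Lemma nbrs_uniq_word s t : uniq s -> t \in nbrs s -> uniq t.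
Proof.
move=> us; rewrite !mem_cat => /or3P[/insertionsP[a nas ->]|/removalP[a es]|].
- by rewrite rcons_uniq nas.
- by move: us; rewrite es rcons_uniq => /andP[].
- case/swapsP=> s1 [a [b [s2 [es ->]]]]; rewrite -(perm_uniq (s1 := s)) //.
  by rewrite es perm_cat2l -[a :: b :: _]/([:: a; b] ++ _)
    -[b :: a :: _]/([:: b; a] ++ _) perm_cat2r; apply/seq.permP => p /=; lia.
Qed.

(** * The rotation graph on words *)

Local Notation tree := (search_tree (star n)).

Lemma word_ex (T : tree) : exists s, uniq s && (word_ffun s == sval T).
Proof.
by have /is_search_tree_word[s us es] := valP T; exists s; rewrite us es eqxx.
Qed.

Definition word (T : tree) : seq 'I_n := xchoose (word_ex T).

Lemma word_uniq T : uniq (word T).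
Proof. by have /andP[] := xchooseP (word_ex T). Qed.

Lemma wordE T : word_ffun (word T) = sval T.
Proof. by have /andP[_ /eqP] := xchooseP (word_ex T). Qed.

Lemma word_inj : injective word.
Proof. by move=> T T' e; apply: val_inj; rewrite /= -!wordE e. Qed.

Lemma nil_is_search_tree : is_search_tree (star n) (word_ffun [::]).
Proof. by apply/is_search_tree_word; exists [::]. Qed.

Definition root_centre : tree := Sub (word_ffun [::]) nil_is_search_tree.

Definition tree_of (s : seq 'I_n) : tree := insubd root_centre (word_ffun s).

Lemma tree_ofK s : uniq s -> word (tree_of s) = s.
Proof.
move=> us; apply: word_ffun_inj => //; first exact: word_uniq.
rewrite wordE; apply: insubdK; by apply/is_search_tree_word; exists s.
Qed.

Lemma wordK T : tree_of (word T) = T.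
Proof. by apply: word_inj; rewrite tree_ofK // word_uniq. Qed.

Lemma rotation_adjE T T' : rotation_adj (star n) T T' = (word T' \in nbrs (word T)).
Proof.
have rotE X Y : rotates_to X Y = (word Y \in nbrs (word X)).
  rewrite /rotates_to -!wordE; apply/idP/idP => [|XY].
    case/existsP=> u /existsP[v /andP[/eqP e1 /eqP e2]].
    have /rotate_nbrs[] : exists u v, word_ffun (word X) v = Some u /\
        word_ffun (word Y) = rotate (star n) (word_ffun (word X)) u v by exists u, v.
      exact: word_uniq.
    move=> t /word_ffun_inj Yt tX; rewrite Yt ?word_uniq //.
    by apply: nbrs_uniq_word tX; apply: word_uniq.
  have [_] := rotate_nbrs (word Y) (word_uniq X); case.
    by exists (word Y).
  by move=> u [v [/eqP e1 /eqP e2]]; apply/existsP; exists u; apply/existsP; exists v;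
    rewrite e1.
rewrite /rotation_adj /= !rotE; apply/orP/idP => [[//|]|]; last by left.
by apply: nbrs_sym; apply: word_uniq.
Qed.

Lemma sum_tree_words (R : nzRingType) (L : seq (seq 'I_n)) (F : seq 'I_n -> R) :
    uniq L -> {in L, forall s, uniq s} ->
  (\sum_(T : tree) (word T \in L)%:R * F (word T) = \sum_(s <- L) F s)%R.
Proof.
move=> uL Lu; rewrite (eq_bigr (fun T : tree => if T \in map tree_of L
                    then F (word T) else 0)%R); last first.
  move=> T _; case: (boolP (T \in _)) => [/mapP[s sL ->]|nT].
    by rewrite tree_ofK ?sL ?mul1r //; apply: Lu.
  case: (boolP (word T \in _)) => [/(map_f tree_of)|_]; last by rewrite mul0r.
  by rewrite wordK (negPf nT).
have un : uniq (map tree_of L).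
  rewrite map_inj_in_uniq // => s t sL tL e.
  by rewrite -[s]tree_ofK ?e ?tree_ofK ?Lu.
rewrite -big_mkcond -big_uniq //= big_map !big_seq; apply: eq_bigr => s sL.
by rewrite tree_ofK ?Lu.
Qed.

Lemma sum_tree_nbrs (R : nzRingType) (F : seq 'I_n -> R) T :
  (\sum_(T' : tree) (rotation_adj (star n) T T')%:R * F (word T') =
   \sum_(s <- nbrs (word T)) F s)%R.
Proof.
under eq_bigr => T' _ do rewrite rotation_adjE.
apply: sum_tree_words; first exact/nbrs_uniq/word_uniq.
by move=> s; apply/nbrs_uniq_word/word_uniq.
Qed.

End StarTrees.

Local Open Scope ring_scope.

(** * Eigenvectors of real symmetric matrices *)

Section RealPart.
Variable R : rcfType.

Lemma map_mx_mul_real (f : R[i] -> R) m n p (U : 'M[R[i]]_(m, n))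
    (B : 'M[R]_(n, p)) :
    (forall z w, f (z + w) = f z + f w) -> f 0 = 0 ->
    (forall z x, f (z * real_complex R x) = f z * x) ->
  map_mx f (U *m map_mx (real_complex R) B) = map_mx f U *m B.
Proof.
move=> fD f0 fM; apply/matrixP=> i j; rewrite !mxE (big_morph f fD f0).
by apply: eq_bigr => k _; rewrite !mxE fM.
Qed.

Lemma map_mx_real_mul (f : R[i] -> R) m n p (B : 'M[R]_(m, n))
    (U : 'M[R[i]]_(n, p)) :
    (forall z w, f (z + w) = f z + f w) -> f 0 = 0 ->
    (forall z x, f (z * real_complex R x) = f z * x) ->
  map_mx f (map_mx (real_complex R) B *m U) = B *m map_mx f U.
Proof.
move=> fD f0 fM; apply/matrixP=> i j; rewrite !mxE (big_morph f fD f0).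
by apply: eq_bigr => k _; rewrite !mxE mulrC fM mulrC.
Qed.

(** A nonzero complex matrix has a nonzero real or imaginary part; taking it
    commutes with multiplication by real matrices. *)
Lemma complex_mx_neq0 m n (U : 'M[R[i]]_(m, n)) :
  U != 0 -> exists f : R[i] -> R,
    [/\ forall z w, f (z + w) = f z + f w, f 0 = 0,
        forall z x, f (z * real_complex R x) = f z * x
      & map_mx f U != 0].
Proof.
move=> U0; have [ReU0|] := eqVneq (map_mx (@complex.Re R) U) 0; last first.
  by exists (@complex.Re R); split=> // [[a b] [c d]|[a b] c] //=;
     rewrite mulr0 subr0.
exists (@complex.Im R); split=> // [[a b] [c d]|[a b] c|] //=.
  by rewrite mulr0 add0r.
apply: contra_neq U0 => ImU0; apply/matrixP=> i j; apply/eqP.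
move/matrixP/(_ i j): ReU0; move/matrixP/(_ i j): ImU0; rewrite !mxE.
by case: (U i j) => a b /= -> ->.
Qed.

End RealPart.

(** The projections [U] of the rows of [V] on the eigenspace of a suitable
    eigenvalue above the Rayleigh quotient.  They inherit every linear relation
    [D *m V = V *m B] in which [B] commutes with [A], since such a [B] commutes
    with the spectral projection; with permutation matrices for [D] and [B] this
    transports symmetries, and with [B = 0] it transports linear dependencies.
    The spectral theorem is applied over the complex numbers; the real or the
    imaginary part of the projected rows has all the required properties. *)
Lemma symmetric_eigenvectors_above (R : rcfType) m n (A : 'M[R]_n)
    (V : 'M[R]_(m, n)) c :
    A^T = A -> c * \tr (V *m V^T) < \tr (V *m A *m V^T) ->
  exists mu, exists U : 'M[R]_(m, n),
    [/\ c < mu, U != 0, U *m A = mu *: U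
      & forall (D : 'M_m) (B : 'M_n),
          A *m B = B *m A -> D *m V = V *m B -> D *m U = U *m B].
Proof.
move=> symA ltc; pose rc := real_complex R.
pose AC := map_mx rc A; pose VC := map_mx rc V.
have rcM x y : rc (x * y) = rc x * rc y by exact: rmorphM.
have conj_rc x : (rc x)^* = rc x by apply/CrealP/complex_realP; exists x.
have hermA : AC \is hermsymmx.
  apply/is_hermitianmxP; rewrite expr0 scale1r; apply/matrixP=> i j.
  by rewrite !mxE conj_rc -[in RHS]symA mxE.
have /orthomx_spectralP eqA := hermitian_normalmx hermA.
have realD := hermitian_spectral_diag_real hermA.
set P := spectralmx AC in eqA; set d := spectral_diag AC in eqA realD.
have unitP : P \in unitmx by apply: spectral_unit.
have tP : invmx P = map_mx Num.conj P^T.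
  by apply: invmx_unitary; apply: spectral_unitarymx.
have {}realD i : exists x, d 0 i = rc x.
  by have /mxOverP/(_ 0 i)/complex_realP := realD.
pose W := VC *m invmx P.
have VW : VC = W *m P by rewrite mulmxKV.
have tV : VC^T = map_mx Num.conj VC^T by apply/matrixP=> i j; rewrite !mxE conj_rc.
have tW : P *m VC^T = map_mx Num.conj W^T.
  by rewrite tV [in LHS]VW trmx_mul map_mxM -tP mulKVmx.
have trA : rc (\tr (V *m A *m V^T)) = \sum_a \sum_i d 0 i * (W a i * (W a i)^*).
  rewrite -[LHS]trace_map_mx !map_mxM -/AC -/VC -map_trmx -/VC eqA.
  rewrite !mulmxA -/W -[_ *m P *m _]mulmxA tW /mxtrace.
  apply: eq_bigr => a _; rewrite mul_mx_diag mxE; apply: eq_bigr => i _.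
  by rewrite !mxE mulrAC mulrA mulrC mulrA.
have trV : rc (\tr (V *m V^T)) = \sum_a \sum_i (W a i * (W a i)^*).
  rewrite -[LHS]trace_map_mx !map_mxM -/VC -map_trmx -/VC [X in X *m _]VW.
  rewrite -[_ *m P *m _]mulmxA tW /mxtrace.
  by apply: eq_bigr => a _; rewrite mxE; apply: eq_bigr => i _; rewrite !mxE.
(* Otherwise every coordinate [i] that contributes to the two traces has
   eigenvalue at most [c], against the hypothesis on the Rayleigh quotient. *)
have [a [i [ci Wai]]] : exists a, exists i, rc c < d 0 i /\ W a i != 0.
  have [/existsP[a /existsP[i /andP[ci Wi]]]|] :=
    boolP [exists a, exists i, (rc c < d 0 i) && (W a i != 0)].
    by exists a, i.
  rewrite negb_exists => /forallP none; move: ltc.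
  rewrite ltNge -(lecR (\tr _)) -/rc trA -[in leRHS]/(rc _) rcM trV mulr_sumr.
  move=> /negP[]; apply: ler_sum => a _; rewrite mulr_sumr.
  apply: ler_sum => i _; have [->|Wai] := eqVneq (W a i) 0.
    by rewrite !mul0r !mulr0.
  have [x dx] := realD i; apply: ler_wpM2r; first exact: mul_conjC_ge0.
  have := none a; rewrite negb_exists => /forallP/(_ i).
  by rewrite Wai andbT dx ltcR lecR -leNgt.
(* [E] is the orthogonal projection on the eigenspace of [mu]. *)
have [mu dmu] := realD i.
pose e : 'rV[R[i]]_n := \row_j (d 0 j == d 0 i)%:R.
pose E := invmx P *m diag_mx e *m P.
pose UC := VC *m E.
have UCP : UC *m invmx P = W *m diag_mx e by rewrite /UC /E !mulmxA mulmxK.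
have UC0 : UC != 0.
  apply: contra_neq Wai => U0; move/matrixP/(_ a i): UCP.
  by rewrite U0 mul0mx mul_mx_diag !mxE eqxx mulr1.
have UCA : UC *m AC = rc mu *: UC.
  have -> : AC = invmx P *m (diag_mx d *m P) by rewrite {1}eqA mulmxA.
  rewrite !mulmxA UCP -dmu -[in RHS](mulmxKV unitP UC) UCP scalemxAl.
  congr (_ *m P); rewrite -mulmxA scalemxAr; congr (W *m _).
  apply/matrixP=> j k; rewrite mul_diag_mx !mxE.
  case: (j == k); last by rewrite !mulr0n !mulr0.
  by case: eqP => [->|_]; rewrite !mulr1n ?mul0r ?mulr0 ?mul1r ?mulr1.
have commE B : AC *m B = B *m AC -> E *m B = B *m E.
  move=> AB; pose B' := P *m B *m invmx P.
  have BE : B = invmx P *m B' *m P by rewrite /B' !mulmxA mulVmx // mul1mx mulmxKV.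
  have dB : diag_mx d *m B' = B' *m diag_mx d.
    have -> : diag_mx d = P *m AC *m invmx P.
      by rewrite {1}eqA !mulmxA mulmxV // mul1mx mulmxK.
    by rewrite /B' !mulmxA !mulmxKV // -[P *m AC *m B]mulmxA AB !mulmxA.
  clearbody B'; rewrite /E BE !mulmxA !mulmxK //; congr (_ *m P); rewrite -!mulmxA.
  congr (_ *m _); apply/matrixP=> j k; rewrite mul_diag_mx mul_mx_diag !mxE.
  move/matrixP/(_ j k): dB; rewrite mul_diag_mx mul_mx_diag !mxE => dB.
  have [->|B0] := eqVneq (B' j k) 0; first by rewrite mulr0 mul0r.
  suff -> : d 0 j = d 0 k by rewrite mulrC.
  by apply: (mulIf B0); rewrite dB mulrC.
have [f [fD f0 fM U0]] := complex_mx_neq0 UC0.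
exists mu, (map_mx f UC); split=> //.
- by rewrite -ltcR -/rc -dmu.
- rewrite -map_mx_mul_real // UCA; apply/matrixP=> j k.
  by rewrite !mxE mulrC fM mulrC.
- move=> D B AB DV; rewrite -map_mx_mul_real // -map_mx_real_mul //.
  congr (map_mx f _); rewrite /UC mulmxA -map_mxM DV map_mxM -[RHS]mulmxA commE.
    by rewrite mulmxA.
  by rewrite -!map_mxM AB.
Qed.

(** The row kernel consists of constant vectors: if [x *m U = 0] and
    [x 0 i != x 0 j], subtracting the transposed relation shows that rows [i] and
    [j] of [U] are equal; by symmetry all rows are then equal, and [U = 0] since
    they sum to zero. *)
Lemma rank_permuted_rows (F : numFieldType) m n (U : 'M[F]_(m, n)) :
    (forall i j, exists B, xrow i j U = U *m B) ->
    const_mx 1 *m U = 0 :> 'rV_n -> U != 0 ->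
  (m - 1 <= \rank U)%N.
Proof.
move=> symU sumU U0.
have rowB i j B k : xrow i j U = U *m B -> row k U *m B = row (tperm i j k) U.
  by move=> eU; rewrite -row_mul -eU; apply/rowP=> l; rewrite !mxE.
have distinct i j : row i U = row j U -> i = j.
  move=> eij; apply/eqP; apply: contraNT U0 => nij.
  have all_eq k : row k U = row i U.
    have [->//|nik] := eqVneq k i; have [->//|njk] := eqVneq k j.
    have [B /rowB rB] := symU j k.
    by rewrite -[in LHS](tpermL j k) -rB -eij rB tpermD // eq_sym.
  have m0 : (m%:R : F) != 0 by rewrite pnatr_eq0; case: (m) {eij nij all_eq} i => [[]|].
  apply/eqP/row_matrixP => k; rewrite row0 all_eq; apply/eqP.
  rewrite -(inj_eq (scalerI m0)) scaler0 -sumU scaler_nat; apply/eqP/rowP=> l.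
  rewrite !mxE (eq_bigr (fun=> U i l)) ?sumr_const ?card_ord ?mxE //=.
    by rewrite mulmxnE mxE.
  by move=> k' _; rewrite mxE mul1r; have /rowP/(_ l) := all_eq k'; rewrite !mxE.
suff : (kermx U <= (const_mx 1 : 'rV[F]_m))%MS.
  move/mxrankS; rewrite mxrank_ker rank_rV => le1.
  by rewrite leq_subLR addnC -leq_subLR (leq_trans le1) // leq_b1.
apply/row_subP=> r; set x := row r _.
have xU : x *m U = 0 by apply/sub_kermxP; rewrite row_sub.
clearbody x => {r}.
have eqx i j : x 0 i = x 0 j.
  have [//|nij] := eqVneq (x 0 i) (x 0 j).
  suff /distinct -> : row i U = row j U by [].
  have nij' : i != j by apply: contra_neq nij => ->.
  have [B eB] := symU i j.
  have : (x - x *m tperm_mx i j) *m U = 0.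
    by rewrite mulmxBl xU -mulmxA -xrowE eB mulmxA xU mul0mx subr0.
  have -> : x - x *m tperm_mx i j = (x 0 i - x 0 j) *: (delta_mx 0 i - delta_mx 0 j).
    rewrite -xcolE; apply/rowP=> l; rewrite !mxE eqxx /=.
    case: tpermP => [->|->|/eqP/negPf-> /eqP/negPf->].
    - by rewrite eqxx (negPf nij') ?(mulr1n, mulr0n); ring.
    - by rewrite eqxx [j == i]eq_sym (negPf nij') ?(mulr1n, mulr0n); ring.
    - by rewrite !mulr0n; ring.
  rewrite -scalemxAl mulmxBl -!rowE => /eqP; rewrite scaler_eq0 subr_eq0.
  by rewrite (negPf nij) subr_eq0 => /eqP.
case: (m) x eqx {xU} => [|m'] x eqx; first by rewrite [x]thinmx0 sub0mx.
apply/sub_rVP; exists (x 0 0); apply/rowP=> l.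
by rewrite !mxE mulr1 (eqx l 0).
Qed.

(** The quadratic form of the Laplacian [d - A], evaluated at an eigenvector. *)
Lemma dirichlet_energy (R : realFieldType) N (A : 'M[R]_N) (d mu : R)
    (u : 'rV[R]_N) :
    A^T = A -> (forall i, \sum_j A i j = d) -> u *m A = mu *: u ->
  \sum_i \sum_j A i j * (u 0 i - u 0 j) ^+ 2 =
  2 * (d - mu) * \sum_i u 0 i ^+ 2.
Proof.
move=> symA regA uA.
have uAi i : \sum_j u 0 j * A j i = mu * u 0 i.
  by move/matrixP/(_ 0 i): uA; rewrite !mxE.
have sA i j : A i j = A j i by rewrite -[in LHS]symA mxE.
have term i : \sum_j A i j * (u 0 i - u 0 j) ^+ 2 =
    (d - 2 * mu) * u 0 i ^+ 2 + \sum_j A i j * u 0 j ^+ 2.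
  transitivity (u 0 i ^+ 2 * (\sum_j A i j)
      - 2 * u 0 i * (\sum_j u 0 j * A j i) + \sum_j A i j * u 0 j ^+ 2).
    rewrite !mulr_sumr -sumrB -big_split /=; apply: eq_bigr => j _.
    by rewrite (sA j i); ring.
  by rewrite regA uAi; congr (_ + _); ring.
rewrite (eq_bigr _ (fun i _ => term i)) big_split /= exchange_big /=.
have -> : \sum_j \sum_i A i j * u 0 j ^+ 2 = \sum_j d * u 0 j ^+ 2.
  apply: eq_bigr => j _; rewrite -mulr_suml -(regA j); congr (_ * _).
  by apply: eq_bigr => i _.
by rewrite -!mulr_sumr; ring.
Qed.

(** * The mean depth of a leaf and its Rayleigh quotient *)

Section Energy.
Variables (R : realFieldType) (n : nat).
Implicit Types (s t : seq 'I_n) (a b : 'I_n).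

(** The position of [a], rescaled so that the positions of a full word are
    symmetric about 0.  For an absent leaf, the value [size s] is the average over
    the possible positions [size s], ..., [n - 1] of [a] in a completion. *)
Definition depth s a : R :=
  if a \in s then 2 * (index a s)%:R - (n%:R - 1) else (size s)%:R.

Definition absent s : R := n%:R - (size s)%:R.

Lemma card_absent s : uniq s -> (#|[pred a | a \notin s]|)%:R = absent s.
Proof.
move=> us; have := cardC (mem s); rewrite card_ord (card_uniqP us) /absent.
move/(congr1 (fun k => k%:R : R)) => <-; rewrite natrD addrC addKr.
by congr (_%:R); apply: eq_card => a; rewrite !inE.
Qed.

Lemma absent_rcons s a : absent (rcons s a) = absent s - 1.
Proof. by rewrite /absent size_rcons -[in LHS]natr1 opprD addrA. Qed.

Lemma depth_rcons s a b : depth (rcons s b) a =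
  if a \in s then depth s a
  else if a == b then 2 * (size s)%:R - (n%:R - 1) else (size s)%:R + 1.
Proof.
rewrite /depth mem_rcons inE -cats1 index_cat size_cat /= addn1 -[(size s).+1%:R]natr1.
have [as_|nas] := boolP (a \in s); first by rewrite orbT.
by rewrite orbF [b == a]eq_sym; case: eqP; rewrite ?addn0.
Qed.

(** The depth in [s] is an average over the completions of [s], hence the
    average of the depths in the one-letter extensions. *)
Lemma depth_harmonic s a : uniq s ->
  \sum_(t <- insertions s) depth t a = absent s * depth s a.
Proof.
move=> us; rewrite /insertions big_map big_filter big_enum_cond /=.
have [as_|nas] := boolP (a \in s).
  under eq_bigr => b _ do rewrite depth_rcons as_.
  by rewrite sumr_const -card_absent // mulr_natl.
rewrite (bigD1 a) //= depth_rcons (negPf nas) eqxx.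
rewrite (eq_bigr (fun=> (size s)%:R + 1)); last first.
  by move=> b /andP[_ ba]; rewrite depth_rcons (negPf nas) eq_sym (negPf ba).
rewrite sumr_const; set k := #|_|; rewrite -[_ *+ k]mulr_natl.
suff -> : k%:R = absent s - 1 by rewrite /depth (negPf nas) /absent; ring.
rewrite -card_absent // (cardD1 a) inE nas natrD [1%:R + _]addrC addrK.
by congr (_%:R); apply: eq_card => b; rewrite !inE andbC.
Qed.

Lemma sum_index_uniq s (F : nat -> R) : uniq s ->
  \sum_(a in s) F (index a s) = \sum_(i < size s) F i.
Proof.
move=> us; rewrite -big_uniq // big_tnth; apply: eq_bigr => i _.
by rewrite (tnth_nth (tnth (in_tuple s) i)) /= index_uniq.
Qed.

(** With [k = size s] and [m = n - k], the letters contribute the sum of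
    [(2 i - (n - 1)) ^ 2] for [i < k] and the absent leaves [m * k ^ 2]. *)
Lemma depth_norm s : uniq s ->
  \sum_a depth s a ^+ 2 = (n%:R ^+ 3 - n%:R - absent s ^+ 3 + absent s) / 3.
Proof.
move=> us; rewrite (bigID [in s]) /=.
under eq_bigr => a as_ do rewrite /depth as_.
rewrite (sum_index_uniq (fun i => (2 * i%:R - (n%:R - 1)) ^+ 2)) //.
under [X in _ + X]eq_bigr => a as_ do rewrite /depth (negPf as_).
rewrite sumr_const -[_ *+ #|_|]mulr_natl card_absent // /absent.
have -> : forall k, \sum_(i < k) (2 * i%:R - (n%:R - 1)) ^+ 2 =
  (n%:R ^+ 3 - n%:R - (n%:R - k%:R) ^+ 3 + (n%:R - k%:R)) / 3
    - (n%:R - k%:R) * k%:R ^+ 2 :> R.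
  elim=> [|k IH]; first by rewrite big_ord0; field.
  by rewrite big_ord_recr /= IH -[k.+1%:R]natr1; field.
by field.
Qed.

(** Removing the last letter [b] does not move the other letters; it lowers the
    depth of [b] to [size s], and that of the absent leaves by 1. *)
Lemma removal_energy s b : uniq (rcons s b) ->
  \sum_a depth (rcons s b) a * (depth (rcons s b) a - depth s a)
    = absent (rcons s b) * (absent (rcons s b) + 1).
Proof.
move=> ub; have /andP[nbs us] : (b \notin s) && uniq s by rewrite -rcons_uniq.
rewrite (bigD1 b) //= depth_rcons (negPf nbs) eqxx {1}/depth (negPf nbs).
rewrite (bigID [in s]) /= big1 ?add0r; last first.
  by move=> a /andP[_ as_]; rewrite depth_rcons as_ subrr mulr0.
rewrite (eq_bigr (fun=> (size s)%:R + 1)); last first.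
  move=> a /andP[/negPf ab nas]; rewrite depth_rcons (negPf nas) ab.
  by rewrite /depth (negPf nas) addrAC subrr add0r mulr1.
rewrite sumr_const; set k := #|_|; rewrite -[_ *+ k]mulr_natl.
suff -> : k%:R = absent s - 1 by rewrite absent_rcons /absent; ring.
rewrite -(absent_rcons s b) -card_absent //; congr (_%:R); apply: eq_card => a.
by rewrite !inE mem_rcons inE negb_or.
Qed.

(** A swap moves two letters of depth difference 2 by 2 in opposite
    directions. *)
Lemma swap_energy s t : uniq s -> t \in swaps s ->
  \sum_a depth s a * (depth s a - depth t a) = 4.
Proof.
move=> us /swapsP[s1 [a [b [s2 [es et]]]]].
have := us; rewrite [X in uniq X]es uniq_catC /= !inE !mem_cat !negb_or.
move=> /andP[/and3P[ab as2 as1] /andP[/andP[bs2 bs1] _]].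
have Ia : index a s = size s1.
  by rewrite es index_cat (negPf as1) /= eqxx addn0.
have Ib : index b s = (size s1).+1.
  by rewrite es index_cat (negPf bs1) /= (negPf ab) eqxx addn1.
have Ja : index a t = (size s1).+1.
  by rewrite et index_cat (negPf as1) /= [b == a]eq_sym (negPf ab) eqxx addn1.
have Jb : index b t = size s1.
  by rewrite et index_cat (negPf bs1) /= eqxx addn0.
have mem_t c : (c \in t) = (c \in s).
  by rewrite es et !mem_cat !inE; do !case: eqP => //=.
have as_ : a \in s by rewrite es mem_cat inE eqxx orbT.
have bs : b \in s by rewrite es mem_cat !inE eqxx !orbT.
rewrite (bigD1 a) //= (bigD1 b) /=; last by rewrite eq_sym.
rewrite /depth !mem_t as_ bs Ia Ib Ja Jb -[_.+1%:R]natr1 big1; first by ring.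
move=> c /andP[ca cb]; rewrite mem_t; case: ifP => cs; last first.
  by rewrite es et !size_cat /= subrr mulr0.
suff -> : index c t = index c s by rewrite subrr mulr0.
rewrite es et !index_cat; case: ifP => //= _.
by rewrite ![_ == c]eq_sym (negPf ca) (negPf cb).
Qed.

Lemma size_swaps s : size (swaps s) = (size s).-1.
Proof.
elim: s => // a [|b t] // IH.
by rewrite -[LHS]/((size [seq a :: i | i <- swaps (b :: t)]).+1) size_map IH.
Qed.

(** Insertions drop out by harmonicity: they use up [absent s] of the [n]
    neighbours.  The empty word has no removal and all its depths vanish; the last
    summand corrects the general formula there. *)
Lemma depth_energy s : uniq s ->
  \sum_a depth s a * (n%:R * depth s a - \sum_(t <- nbrs s) depth t a) =
  4 * (n%:R - absent s - 1) + absent s * (absent s + 1)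
    + (s == [::])%:R * (4 - n%:R * (n%:R + 1)).
Proof.
case/lastP: s => [_|s b us].
  by rewrite big1 => [|a _]; rewrite /depth /absent /= ?mul0r //; ring.
have -> : (rcons s b == [::]) = false by case: (s).
rewrite mul0r addr0 -removal_energy //.
have sw : \sum_a \sum_(t <- swaps (rcons s b))
    depth (rcons s b) a * (depth (rcons s b) a - depth t a) = 4 * (size s)%:R.
  rewrite exchange_big /= big_seq (eq_bigr (fun=> 4)); last first.
    by move=> t; apply: swap_energy.
  rewrite -big_seq big_const_seq count_predT size_swaps size_rcons.
  by rewrite iter_addr_0 mulr_natr.
have -> : n%:R - absent (rcons s b) - 1 = (size s)%:R.
  by rewrite absent_rcons /absent; ring.
rewrite -sw -big_split /=; apply: eq_bigr => a _; rewrite /nbrs.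
have -> : removal (rcons s b) = [:: s].
  by case: (s) => //= c s'; rewrite belast_rcons.
rewrite !big_cat big_seq1 /= depth_harmonic //.
rewrite -mulr_sumr sumrB big_const_seq count_predT size_swaps size_rcons iter_addr_0.
by rewrite -mulr_natr absent_rcons /absent /=; ring.
Qed.

Local Notation tree := (search_tree (star n)).
Local Notation missing T := (absent (word T)).

(** Each absent leaf of [T] is an insertion into [T], and each nonempty word is
    obtained by exactly one insertion, from a word with one more absent leaf.  The
    subtracted term is that of the empty word. *)
Lemma moment_shift (F : R -> R) :
  \sum_(T : tree) missing T * F (missing T) =
  \sum_(T : tree) F (missing T + 1) - F (n%:R + 1).
Proof.
have ins (T : tree) : missing T * F (missing T) =
    \sum_(T' : tree) (word T' \in insertions (word T))%:R * F (missing T).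
  rewrite (sum_tree_words (fun=> F (missing T))) /insertions.
  - rewrite big_map big_filter big_enum_cond sumr_const.
    by rewrite -card_absent ?word_uniq // mulr_natl.
  - by have := nbrs_uniq (word_uniq T); rewrite cat_uniq => /andP[].
  - move=> s sT; apply: (nbrs_uniq_word (word_uniq T)).
    by rewrite mem_cat sT.
under eq_bigr => T _ do rewrite ins; rewrite exchange_big /=.
have rem (T' : tree) :
    \sum_(T : tree) (word T' \in insertions (word T))%:R * F (missing T)
   = F (missing T' + 1) - (word T' \in [:: [::]])%:R * F (n%:R + 1).
  rewrite (eq_bigr (fun T => (word T \in removal (word T'))%:R * F (missing T))).
    rewrite (sum_tree_words (fun s => F (absent s))).
    - case/lastP: (word T') => [|s b].
        by rewrite big_nil /absent /= !subr0 mul1r subrr.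
      have -> : removal (rcons s b) = [:: s].
        by case: (s) => //= c s'; rewrite belast_rcons.
      rewrite big_seq1 absent_rcons addrNK; have -> : (rcons s b \in [:: [::]]) = false.
        by case: (s).
      by rewrite mul0r subr0.
    - by case: (word T').
    - move=> s sT; apply: (nbrs_uniq_word (word_uniq T')).
      by rewrite !mem_cat sT orbT.
  move=> T _; congr ((_ : bool)%:R * _); apply/insertionsP/removalP => [[a _ ->]|[a e]].
    by exists a.
  by exists a => //; have := word_uniq T'; rewrite e rcons_uniq => /andP[].
under eq_bigr => T _ do rewrite rem; rewrite sumrB; congr (_ - _).
rewrite (sum_tree_words (fun=> F (n%:R + 1))) ?big_seq1 // => s.
by rewrite inE => /eqP->.
Qed.

(** Writing S for the number of trees, [moment_shift] expresses both sides as
    affine functions of S with coefficients in n.  For n >= 3 the coefficient of S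
    in their difference has the right sign; for n = 2 the third factorial moment
    vanishes, whence S = 5. *)
Lemma rayleigh_gap : (2 <= n)%N ->
  \sum_(T : tree) \sum_a depth (word T) a *
      (n%:R * depth (word T) a - \sum_(t <- nbrs (word T)) depth t a)
  < (3 / n%:R + 1 / (n%:R ^+ 2 - n%:R)) *
    \sum_(T : tree) \sum_a depth (word T) a ^+ 2.
Proof.
move=> n2; have x2 : 2 <= n%:R :> R by rewrite ler_nat.
have A1 := moment_shift (fun=> 1); have A2 := moment_shift (fun x => x - 1).
have A3 := moment_shift (fun x => (x - 1) * (x - 2)).
have x3 : n%:R = 2 :> R /\
      \sum_(T : tree) missing T * ((missing T - 1) * (missing T - 2)) = 0
   \/ 3 <= n%:R :> R.
  move: n2; rewrite leq_eqVlt => /predU1P[n2|n3]; last by right; rewrite ler_nat.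
  have xn : n%:R = 2 :> R by rewrite -n2.
  left; split=> //; rewrite big1 // => T _; have : (size (word T) <= 2)%N.
    rewrite n2; have := max_card (mem (word T)).
    by rewrite card_ord (card_uniqP (word_uniq T)).
  by rewrite /absent xn; case: (size _) => [|[|[|]]] // _; ring.
under eq_bigr => T _ do rewrite depth_energy ?word_uniq //.
under [X in _ < _ * X]eq_bigr => T _ do rewrite depth_norm ?word_uniq //.
have S0 : \sum_(T : tree) (1 : R) >= 0 by apply: sumr_ge0.
set S := \sum_(T : tree) 1 in S0 A1.
set B1 := \sum_(T : tree) missing T * 1 in A1.
set B2 := \sum_(T : tree) missing T * (missing T - 1) in A2.
set B3 := \sum_(T : tree) missing T * ((missing T - 1) * (missing T - 2)) in A3 x3.
have e2 : B2 = B1 - n%:R.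
  rewrite A2; congr (_ - _); last by ring.
  by apply: eq_bigr => T _; ring.
have e3 : B3 = B2 - n%:R * (n%:R - 1).
  rewrite A3; congr (_ - _); last by ring.
  by apply: eq_bigr => T _; ring.
have eC : \sum_(T : tree) (4 * (n%:R - missing T - 1) + missing T * (missing T + 1)
      + (word T == [::])%:R * (4 - n%:R * (n%:R + 1))) =
    (4 * (n%:R - 1)) * S - 2 * B1 + B2 + (4 - n%:R * (n%:R + 1)).
  have e0 : \sum_(T : tree) (word T == [::])%:R * (4 - n%:R * (n%:R + 1)) =
      4 - n%:R * (n%:R + 1) :> R.
    under eq_bigr => T _ do rewrite -mem_seq1.
    rewrite (sum_tree_words (fun=> 4 - n%:R * (n%:R + 1))) ?big_seq1 // => s.
    by rewrite inE => /eqP->.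
  rewrite -[in RHS]e0 !mulr_sumr -sumrB -!big_split /=; apply: eq_bigr => T _.
  by congr (_ + _); ring.
have eN : \sum_(T : tree) (n%:R ^+ 3 - n%:R - missing T ^+ 3 + missing T) / 3 =
    ((n%:R ^+ 3 - n%:R) * S - B3 - 3 * B2) / 3.
  rewrite !mulr_sumr -!sumrB mulr_suml; apply: eq_bigr => T _.
  by congr (_ / _); ring.
rewrite {}eC {}eN {A2 A3}.
move: n%:R x2 x3 e2 e3 A1 => x x2 x3 e2 e3 A1.
have -> : 3 / x + 1 / (x ^+ 2 - x) = (3 * x - 2) / (x * (x - 1)).
  have x0 : x != 0 by apply: lt0r_neq0; lra.
  have x1 : x - 1 != 0 by apply: lt0r_neq0; lra.
  have -> : x ^+ 2 - x = x * (x - 1) by ring.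
  by field; rewrite x0 x1.
rewrite mulf_div ltr_pdivlMr; last by nra.
rewrite {}e3 {}e2 {}A1 in x3 *.
case: x3 => [[-> S5]|x3]; first by nra.
rewrite -subr_gt0; set y := x - 3; have y0 : 0 <= y by rewrite /y subr_ge0.
have -> : x = y + 3 by rewrite /y; ring.
(* Expanded at x = 3, the difference of the two sides has nonnegative
   coefficients. *)
suff : 0 < S * (3 * y ^+ 4 + 22 * y ^+ 3 + 60 * y ^+ 2 + 65 * y + 14)
   + (3 * y + 7) * ((y + 3) ^+ 2 + 3 * (y + 3) + 4)
   + 3 * (y + 3) * (y + 2) * (y ^+ 2 + 8 * y + 10).
  by congr (_ < _); ring.
have y_ge0 k : 0 <= y ^+ k by apply: exprn_ge0.
apply: ltr_wpDr; first by rewrite !mulr_ge0 //; nra.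
apply: ltr_wpDl; last by rewrite mulr_gt0 //; nra.
rewrite mulr_ge0 //; have := y_ge0 2%N; have := y_ge0 3%N; have := y_ge0 4%N; lra.
Qed.

End Energy.

(** * The spectrum of the rotation graph *)

Section RotationSpectrum.
Variables (R : realType) (n : nat).
Local Notation tree := (search_tree (star n)).
Local Notation A := (adjmx R (rotation_adj (star n))).

Lemma sum_enum_val (F : tree -> R) :
  \sum_(i < #|{: tree}|) F (enum_val i) = \sum_T F T.
Proof. by rewrite [RHS](reindex _ (onW_bij _ (@enum_val_bij _))). Qed.

Lemma adj_sym : A^T = A.
Proof. by apply/matrixP=> i j; rewrite !mxE /rotation_adj /= orbC. Qed.

Lemma adj_regular i : \sum_j A i j = n%:R.
Proof.
under eq_bigr => j _ do rewrite mxE.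
rewrite (sum_enum_val (fun T => (rotation_adj (star n) (enum_val i) T)%:R)).
set T := enum_val i; under eq_bigr => T' _ do rewrite -[_%:R]mulr1.
rewrite (sum_tree_nbrs (fun=> 1)) big_const_seq count_predT iter_addr_0.
have us := word_uniq T.
have sz : size (insertions (word T)) = #|[pred a | a \notin word T]|.
  by rewrite size_map cardE [in RHS]/enum_mem -enumT; congr size.
rewrite /nbrs !size_cat sz !natrD card_absent // size_swaps /absent.
case: (word T) => [|a s] /=; first by ring.
by rewrite -natr1; ring.
Qed.

(** The rotation graph is connected: removing letters leads from any word to
    the empty one. *)
Lemma tree_edge_const (f : tree -> R) :
  (forall T T', rotation_adj (star n) T T' -> f T = f T') ->
  forall T, f T = f (root_centre n).
Proof.
move=> fE T; have -> : root_centre n = tree_of [::].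
  apply: word_inj; rewrite tree_ofK //; apply: word_ffun_inj => //.
    exact: word_uniq.
  by rewrite wordE.
rewrite -[T]wordK; elim/last_ind: (word T) (word_uniq T) => [|s a IH] // us.
have us' : uniq s by move: us; rewrite rcons_uniq => /andP[].
rewrite -IH //; apply: fE; rewrite rotation_adjE !tree_ofK // !mem_cat.
by apply/or3P; constructor 2; apply/removalP; exists a.
Qed.

(** The Dirichlet energy is nonnegative, so it vanishes as soon as the
    eigenvalue is at least the degree. *)
Lemma top_eigenvector_const mu (u : 'rV[R]_#|{: tree}|) :
  u *m A = mu *: u -> n%:R <= mu -> forall i j, u 0 i = u 0 j.
Proof.
move=> uA nmu; have := dirichlet_energy adj_sym adj_regular uA => energy.
have A0 i j : 0 <= A i j * (u 0 i - u 0 j) ^+ 2.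
  by rewrite mulr_ge0 ?sqr_ge0 // mxE ler0n.
have e0 : \sum_i \sum_j A i j * (u 0 i - u 0 j) ^+ 2 = 0.
  apply/eqP; rewrite eq_le sumr_ge0 ?andbT => [|i _]; last exact: sumr_ge0.
  rewrite energy -mulrA mulr_ge0_le0 // mulr_le0_ge0 ?subr_le0 //.
  by apply: sumr_ge0 => i _; apply: sqr_ge0.
have edge i j : A i j * (u 0 i - u 0 j) ^+ 2 = 0.
  have /psumr_eq0P : \sum_i \sum_j A i j * (u 0 i - u 0 j) ^+ 2 = 0 by [].
  move/(_ (fun i _ => sumr_ge0 _ (fun j _ => A0 i j)))/(_ i isT).
  by move/psumr_eq0P => /(_ (fun j _ => A0 i j))/(_ j isT).
have constE T : u 0 (enum_rank T) = u 0 (enum_rank (root_centre n)).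
  apply: (tree_edge_const (f := fun T => u 0 (enum_rank T))) => X Y XY.
  have /eqP := edge (enum_rank X) (enum_rank Y).
  by rewrite mxE !enum_rankK XY mul1r sqrf_eq0 subr_eq0 => /eqP.
move=> i j; rewrite -(enum_valK i) -(enum_valK j).
by rewrite !constE.
Qed.

Lemma eigenvalue_degree : eigenvalue A n%:R.
Proof.
apply/eigenvalueP; exists (const_mx 1).
  apply/rowP=> j; rewrite !mxE mulr1 -(adj_regular j).
  by apply: eq_bigr => i _; rewrite mxE mul1r -[in LHS]adj_sym mxE.
apply/eqP=> /rowP/(_ (enum_rank (root_centre n))); rewrite !mxE => /eqP.
by rewrite oner_eq0.
Qed.

Lemma eigenvalue_le_degree mu : eigenvalue A mu -> mu <= n%:R.
Proof.
case/eigenvalueP=> u uA u0.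
have := dirichlet_energy adj_sym adj_regular uA => energy.
have u2 : 0 < \sum_i u 0 i ^+ 2.
  rewrite lt_def sumr_ge0 ?andbT => [|i _]; last exact: sqr_ge0.
  apply: contraNneq u0 => /psumr_eq0P u0; apply/eqP/rowP=> i.
  by apply/eqP; rewrite mxE -sqrf_eq0 u0 // => j _; apply: sqr_ge0.
have : 0 <= 2 * (n%:R - mu) * \sum_i u 0 i ^+ 2.
  rewrite -energy; apply: sumr_ge0 => i _; apply: sumr_ge0 => j _.
  by rewrite mulr_ge0 ?sqr_ge0 // mxE ler0n.
by rewrite (pmulr_lge0 _ u2) pmulr_rge0 ?subr_ge0 // ltr0n.
Qed.

Definition relabel (f : {perm 'I_n}) (T : tree) : tree := tree_of (map f (word T)).

Lemma word_relabel f T : word (relabel f T) = map f (word T).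
Proof. by rewrite tree_ofK // map_inj_uniq ?word_uniq //; apply: perm_inj. Qed.

Lemma relabel_inj f : injective (relabel f).
Proof.
move=> T T' /(congr1 (@word n)); rewrite !word_relabel => /inj_map e.
by apply/word_inj/e/perm_inj.
Qed.

Lemma rotation_adj_relabel f T T' :
  rotation_adj (star n) (relabel f T) (relabel f T') = rotation_adj (star n) T T'.
Proof.
rewrite !rotation_adjE !word_relabel; apply/idP/idP; last exact/nbrs_map/perm_inj.
by move/(nbrs_map (f := f^-1%g) perm_inj); rewrite -!map_comp !map_id_in => // x _ /=;
  rewrite permK.
Qed.

Definition relabel_ord f (i : 'I_#|{: tree}|) := enum_rank (relabel f (enum_val i)).

Lemma relabel_ord_inj f : injective (relabel_ord f).
Proof. by move=> i j /enum_rank_inj/relabel_inj/enum_val_inj. Qed.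

(** The automorphism [relabel f] as a permutation of the indices of the
    adjacency matrix. *)
Definition relabel_perm f := perm (@relabel_ord_inj f).

Lemma adj_relabel f :
  A *m perm_mx (relabel_perm f)^-1 = perm_mx (relabel_perm f)^-1 *m A.
Proof.
rewrite -col_permE -row_permE; apply/matrixP=> i j; rewrite !mxE.
rewrite -{1}(permKV (relabel_perm f) i); set k := fun_of_perm _ i.
rewrite ![relabel_perm f _]permE /relabel_ord !enum_rankK.
by rewrite rotation_adj_relabel.
Qed.

Definition depth_mx : 'M[R]_(n, #|{: tree}|) :=
  \matrix_(a, i) depth R (word (enum_val i)) a.

Lemma depth_map (f : {perm 'I_n}) (s : seq 'I_n) a :
  depth R (map f s) (f a) = depth R s a.
Proof. by rewrite /depth size_map mem_map ?index_map //; apply: perm_inj. Qed.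

Lemma depth_mx_relabel (f : {perm 'I_n}) :
  perm_mx f^-1 *m depth_mx = depth_mx *m perm_mx (relabel_perm f)^-1.
Proof.
rewrite -row_permE -col_permE; apply/matrixP=> a i; rewrite !mxE.
rewrite [relabel_perm f i]permE /relabel_ord enum_rankK word_relabel -{2}(permKV f a).
by rewrite depth_map.
Qed.

Lemma sum_depth (s : seq 'I_n) : uniq s -> \sum_a depth R s a = 0.
Proof.
move=> us; rewrite (bigID [in s]) /=.
under eq_bigr => a as_ do rewrite /depth as_.
rewrite (sum_index_uniq (fun i => (2 * i%:R - (n%:R - 1)))) //.
under [X in _ + X]eq_bigr => a as_ do rewrite /depth (negPf as_).
rewrite sumr_const -[_ *+ #|_|]mulr_natl card_absent // /absent.
have -> : forall k, \sum_(i < k) (2 * i%:R - (n%:R - 1)) =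
    - (n%:R - k%:R) * k%:R :> R.
  elim=> [|k IH]; first by rewrite big_ord0 mulr0.
  by rewrite big_ord_recr /= IH -[k.+1%:R]natr1; ring.
by ring.
Qed.

Lemma depth_mx_rayleigh : (2 <= n)%N ->
  (n%:R - (3 / n%:R + 1 / (n%:R ^+ 2 - n%:R))) * \tr (depth_mx *m depth_mx^T)
  < \tr (depth_mx *m A *m depth_mx^T).
Proof.
move=> n2; have := rayleigh_gap R n2; set c := _ + _ / _.
have -> : \tr (depth_mx *m depth_mx^T) = \sum_(T : tree) \sum_a depth R (word T) a ^+ 2.
  rewrite -sum_enum_val exchange_big; apply: eq_bigr => a _ /=.
  by rewrite mxE; apply: eq_bigr => i _; rewrite !mxE.
have -> : \tr (depth_mx *m A *m depth_mx^T) =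
    \sum_(T : tree) \sum_a depth R (word T) a * \sum_(t <- nbrs (word T)) depth R t a.
  rewrite -sum_enum_val exchange_big; apply: eq_bigr => a _ /=.
  rewrite mxE; apply: eq_bigr => i _; rewrite !mxE mulrC; congr (_ * _).
  rewrite -(sum_tree_nbrs (fun s => depth R s a)) -sum_enum_val.
  by apply: eq_bigr => j _; rewrite !mxE mulrC /rotation_adj /= orbC.
suff -> : \sum_(T : tree) \sum_a depth R (word T) a *
    (n%:R * depth R (word T) a - \sum_(t <- nbrs (word T)) depth R t a) =
  n%:R * \sum_(T : tree) \sum_a depth R (word T) a ^+ 2 -
  \sum_(T : tree) \sum_a depth R (word T) a * \sum_(t <- nbrs (word T)) depth R t a.
  by move=> h; rewrite mulrBl; lra.
rewrite mulr_sumr -sumrB; apply: eq_bigr => T _.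
by rewrite mulr_sumr -sumrB; apply: eq_bigr => a _; ring.
Qed.

End RotationSpectrum.

Theorem theorem9 (R : realType) (n : nat) (hn : (2 <= n)%N) :
  let A := adjmx R (rotation_adj (star n)) in
  (exists mu : R,
     [/\ eigenvalue A mu,
         (n - 1 <= \rank (eigenspace A mu))%N,
         `|mu| < n%:R
       & n%:R - 3%:R / n%:R - 1 / (n%:R ^+ 2 - n%:R) < `|mu| ]) /\
  (eigenvalue A n%:R /\ forall lambda : R, eigenvalue A lambda -> lambda <= n%:R).
Proof.
move=> A; split; last first.
  by split; [exact: eigenvalue_degree | exact: eigenvalue_le_degree].
have [mu [U [gap U0 UA inherit]]] :=
  symmetric_eigenvectors_above (adj_sym R n) (depth_mx_rayleigh R hn).
(* The relabellings and the relation saying that the rows sum to zero are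
   transported from the depth functions to their projections. *)
have symU a b : xrow a b U = U *m perm_mx (relabel_perm (tperm a b))^-1.
  rewrite xrowE; apply: inherit; first exact: adj_relabel.
  by rewrite -depth_mx_relabel tpermV.
have sumU : const_mx 1 *m U = 0 :> 'rV_#|{: search_tree (star n)}|.
  have : const_mx 1 *m U = U *m 0 :> 'M_(n, _).
    apply: inherit; rewrite ?mulmx0 ?mul0mx //; apply/matrixP=> a i.
    rewrite !mxE -[RHS](sum_depth R (word_uniq (enum_val i))).
    by apply: eq_bigr => b _; rewrite !mxE mul1r.
  rewrite mulmx0 => /(congr1 (row (Ordinal (ltnW hn)))).
  by rewrite row_mul row_const row0.
have rankU : (n - 1 <= \rank U)%N.
  by apply: rank_permuted_rows => // a b; eexists; apply: symU.
have sub : (U <= eigenspace A mu)%MS by apply/eigenspaceP.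
(* An eigenvalue at least [n] would make the rows of [U] constant functions;
   permuting the trees then fixes them, so they coincide. *)
have mu_lt : mu < n%:R.
  rewrite ltNge; apply: contra U0 => nmu.
  have const a i j : U a i = U a j.
    have := @top_eigenvector_const _ _ mu (row a U); rewrite -row_mul UA linearZ.
    by move/(_ erefl nmu i j); rewrite !mxE.
  have rows a b i : U a i = U b i.
    have /matrixP/(_ b i) := symU a b; rewrite -col_permE !mxE tpermR => ->.
    exact: const.
  apply/eqP/matrixP=> a i; move/rowP/(_ i): sumU; rewrite !mxE.
  rewrite (eq_bigr (fun=> U a i)); last by move=> b _; rewrite mxE mul1r (rows b a).
  rewrite sumr_const card_ord => /eqP; rewrite mulrn_eq0 => /orP[|/eqP //].
  by rewrite -leqn0 leqNgt (leq_trans _ hn).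
have x2 : 2 <= n%:R :> R by rewrite ler_nat.
(* The lower bound is nonnegative: n (n - 1) times it is
   (n - 2) (n^2 + n - 1). *)
have mu_ge0 : 0 <= mu.
  apply: le_trans (ltW gap); rewrite subr_ge0.
  move: (n%:R) x2 => x x2.
  have x0 : x != 0 by apply: lt0r_neq0; lra.
  have x1 : x - 1 != 0 by apply: lt0r_neq0; lra.
  have -> : 3 / x + 1 / (x ^+ 2 - x) = (3 * x - 2) / (x * (x - 1)).
    have -> : x ^+ 2 - x = x * (x - 1) by ring.
    by field; rewrite x0 x1.
  rewrite ler_pdivrMr; last by nra.
  rewrite -subr_ge0 (_ : _ - _ = (x - 2) * (x ^+ 2 + x - 1)); last by ring.
  by rewrite mulr_ge0 //; nra.
exists mu; rewrite ger0_norm //; split=> //.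
- rewrite /eigenvalue -submx0; apply: contra U0 => e0.
  by rewrite -submx0 (submx_trans sub).
- exact: leq_trans rankU (mxrankS sub).
- by move: gap; rewrite opprD addrA.
Qed.
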